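(* Let $\mathbf{A}\in\mathbb{C}^{m\times n}$. Let $\mathbf{W}^{-}\in\mathbb{C}^{m\times q}$ be block diagonal with $l$ diagonal blocks $\mathbf{W}^{-}_i\in\mathbb{C}^{m_i\times q_i}$ of rank $q_i$, with singular value decompositions $\mathbf{W}^{-}_i=\mathbf{U}^{-}_i\mathbf{I}^{q_i}_{m_i}\mathbf{N}^{-}_i(\mathbf{V}^{-}_i)^*$, and let $\mathbf{W}^{+}\in\mathbb{C}^{n\times r}$ be block diagonal with $k$ diagonal blocks $\mathbf{W}^{+}_j\in\mathbb{C}^{n_j\times r_j}$ of rank $r_j$, with singular value decompositions $\mathbf{W}^{+}_j=\mathbf{U}^{+}_j\mathbf{I}^{r_j}_{n_j}\mathbf{N}^{+}_j(\mathbf{V}^{+}_j)^*$. Let $\mathbf{U}^{\pm},\mathbf{V}^{\pm}$ be the block diagonal matrices with diagonal blocks $\mathbf{U}^{\pm}_i,\mathbf{V}^{\pm}_i$, let $\mathbf{\Omega}^{-}$ and $\mathbf{\Omega}^{+}$ be the permutation matrices of $\Omega^{(q_1,\ldots,q_l)}_{(m_1,\ldots,m_l)}$ and $\Omega^{(r_1,\ldots,r_k)}_{(n_1,\ldots,n_k)}$, and write $$\hat{\mathbf{A}}=(\mathbf{\Omega}^{-})^*(\mathbf{U}^{-})^*\mathbf{A}\mathbf{U}^{+}\mathbf{\Omega}^{+}=\begin{pmatrix}\mathbf{E}&(\mathbf{D}^{+})^*\\ \mathbf{D}^{-}&\mathbf{F}\end{pmatrix}\quad\text{with }\mathbf{E}\in\mathbb{C}^{q\times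 r}.$$ Let $\lVert\cdot\rVert_U$ be a unitarily invariant matrix norm. Then $\mathbf{E}$ and the Rayleigh quotient $\mathbf{E}^0$ are unitarily equivalent, $\mathbf{D}^{-}$ and $\mathbf{T}^{-}$ have the same singular values, $\mathbf{D}^{+}$ and $\mathbf{T}^{+}$ have the same singular values, and $$\lVert\mathbf{T}^{-}\rVert_U=\min_{\mathbf{\Theta}\in\mathbb{C}^{q\times r}}\lVert\mathbf{A}\mathbf{U}^{+}\mathbf{I}^{\mathbf{r}}_{\mathbf{n}}(\mathbf{V}^{+})^*-\mathbf{U}^{-}\mathbf{I}^{\mathbf{q}}_{\mathbf{m}}(\mathbf{V}^{-})^*\mathbf{\Theta}\rVert_U,$$ $$\lVert\mathbf{T}^{+}\rVert_U=\min_{\mathbf{\Theta}\in\mathbb{C}^{q\times r}}\lVert\mathbf{A}^*\mathbf{U}^{-}\mathbf{I}^{\mathbf{q}}_{\mathbf{m}}(\mathbf{V}^{-})^*-\mathbf{U}^{+}\mathbf{I}^{\mathbf{r}}_{\mathbf{n}}(\mathbf{V}^{+})^*\mathbf{\Theta}^*\rVert_U.$$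
   Context: $\mathbf{X}^*$ is conjugate transpose. For $r\le n$, $\mathbf{I}^r_n=\begin{pmatrix}\mathbf{I}_r\\ \mathbf{0}\end{pmatrix}\in\{0,1\}^{n\times r}$; for sequences $\mathbf{r}=(r_1,\ldots,r_k)$, $\mathbf{n}=(n_1,\ldots,n_k)$ with $r_i\le n_i$, $\mathbf{I}^{\mathbf{r}}_{\mathbf{n}}=\operatorname{diag}(\mathbf{I}^{r_1}_{n_1},\ldots,\mathbf{I}^{r_k}_{n_k})$; similarly $\mathbf{q}=(q_1,\ldots,q_l)$, $\mathbf{m}=(m_1,\ldots,m_l)$. $m=\sum m_i$, $q=\sum q_i$, $n=\sum n_j$, $r=\sum r_j$; $\mathbf{A}$ is partitioned into blocks $\mathbf{A}_{ij}\in\mathbb{C}^{m_i\times n_j}$. In the SVDs $\mathbf{U}^{\pm}_i,\mathbf{V}^{\pm}_i$ are square unitary and $\mathbf{N}^{\pm}_i$ square real diagonal with positive diagonal. The permutation $\Omega^{\mathbf{r}}_{\mathbf{n}}$ of $\{1,\ldots,n\}$ is, for $1\le s_i\le n_i$: $\Omega^{\mathbf{r}}_{\mathbf{n}}(s_i+\sum_{j<i}n_j)=s_i+\sum_{j<i}r_j$ if $s_i\le r_i$, and $=s_i-r_i+r+\sum_{j<i}(n_j-r_j)$ if $s_i>r_i$ (the first $r_i$ indices of each block go, in order, to $\{1,\ldots,r\}$, the rest in order to $\{r+1,\ldots,n\}$); its permutation matrix $\mathbf{\Omega}$ has $\mathbf{\Omega}_{u,\Omega^{\mathbf{r}}_{\mathbf{n}}(u)}=1$,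 so that $\mathbf{\Omega}^*\mathbf{I}^{\mathbf{r}}_{\mathbf{n}}=\mathbf{I}^{r}_{n}$. Rayleigh quotient: $\mathbf{E}^0\in\mathbb{C}^{q\times r}$ with blocks $\mathbf{E}^0_{ij}=\mathbf{V}^{-}_i(\mathbf{I}^{q_i}_{m_i})^*(\mathbf{U}^{-}_i)^*\mathbf{A}_{ij}\mathbf{U}^{+}_j\mathbf{I}^{r_j}_{n_j}(\mathbf{V}^{+}_j)^*$, i.e. $\mathbf{E}^0=\mathbf{V}^{-}(\mathbf{I}^{\mathbf{q}}_{\mathbf{m}})^*(\mathbf{U}^{-})^*\mathbf{A}\mathbf{U}^{+}\mathbf{I}^{\mathbf{r}}_{\mathbf{n}}(\mathbf{V}^{+})^*$. Deviation matrices: $\mathbf{T}^{-}=\mathbf{A}\mathbf{U}^{+}\mathbf{I}^{\mathbf{r}}_{\mathbf{n}}(\mathbf{V}^{+})^*-\mathbf{U}^{-}\mathbf{I}^{\mathbf{q}}_{\mathbf{m}}(\mathbf{V}^{-})^*\mathbf{E}^0\in\mathbb{C}^{m\times r}$ and $\mathbf{T}^{+}=\mathbf{A}^*\mathbf{U}^{-}\mathbf{I}^{\mathbf{q}}_{\mathbf{m}}(\mathbf{V}^{-})^*-\mathbf{U}^{+}\mathbf{I}^{\mathbf{r}}_{\mathbf{n}}(\mathbf{V}^{+})^*(\mathbf{E}^0)^*\in\mathbb{C}^{n\times q}$. Two matrices $\mathbf{X},\mathbf{Y}$ are unitarily equivalent if $\mathbf{X}=\mathbf{P}\mathbf{Y}\mathbf{Q}$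 with $\mathbf{P},\mathbf{Q}$ unitary. *)

(* Defs.v *)
(* MathComp; the complex numbers are [R[i]] for [R : realType]. *)
Set Warnings "-notation-overridden,-ambiguous-paths".
From mathcomp Require Export all_boot all_order all_fingroup all_algebra.
From mathcomp Require Export reals.
From mathcomp Require Export complex.

Set Implicit Arguments.
Unset Strict Implicit.
Unset Printing Implicit Defensive.

Import Order.TTheory GRing.Theory Num.Theory.

Local Open Scope ring_scope.
Local Open Scope sesquilinear_scope.

Section BlockPermutation.
Context {k : nat} (n_ r_ : 'I_k -> nat).
Hypothesis le_rn : forall i, (r_ i <= n_ i)%N.
Import tagnat.

Lemma leq_sum_sizes : (\sum_i r_ i <= \sum_i n_ i)%N.
Proof. by apply: leq_sum => i _; apply: le_rn. Qed.

Lemma sum_sizesK :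
  (\sum_i r_ i + (\sum_i n_ i - \sum_i r_ i) = \sum_i n_ i)%N.
Proof. exact: subnKC leq_sum_sizes. Qed.

(* All indices start at 0: the index [u] is [sig2 u + \sum_(j < sig1 u) n_ j],
   where [sig1 u] is its block and [sig2 u < n_ (sig1 u)] its offset there. *)
Definition omega_nat (u : 'I_(\sum_i n_ i)) : nat :=
  if (sig2 u < r_ (sig1 u))%N
  then (sig2 u + \sum_(j < k | (j < sig1 u)%N) r_ j)%N
  else (sig2 u - r_ (sig1 u) + \sum_(j < k) r_ j
        + \sum_(j < k | (j < sig1 u)%N) (n_ j - r_ j))%N.

Lemma omega_natP (u : 'I_(\sum_i n_ i)) :
  (exists2 s : 'I_(r_ (sig1 u)),
     s = sig2 u :> nat & omega_nat u = @Rank _ r_ _ s)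
  \/ (exists2 s : 'I_(n_ (sig1 u) - r_ (sig1 u)),
     (s + r_ (sig1 u))%N = sig2 u :> nat &
     omega_nat u = (\sum_i r_ i + @Rank _ (fun i => n_ i - r_ i)%N _ s)%N).
Proof.
rewrite /omega_nat; case: ltnP => h; [left | right].
  by exists (Ordinal h) => //; rewrite RankEsum addnC.
have hs : (sig2 u - r_ (sig1 u) < n_ (sig1 u) - r_ (sig1 u))%N.
  by rewrite ltn_sub2rE.
exists (Ordinal hs); first exact: subnK h.
by rewrite RankEsum /= addnA [RHS]addnAC; congr (_ + _)%N; rewrite addnC.
Qed.

Lemma omega_nat_lt (u : 'I_(\sum_i n_ i)) : (omega_nat u < \sum_i n_ i)%N.
Proof.
have [[s _ ->]|[s _ ->]] := omega_natP u.
  exact: leq_trans (ltn_ord _) leq_sum_sizes.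
have -> : (\sum_i n_ i = \sum_i r_ i + \sum_i (n_ i - r_ i))%N.
  by rewrite -big_split /=; apply: eq_bigr => i _; rewrite subnKC.
by rewrite ltn_add2l ltn_ord.
Qed.

Definition omega (u : 'I_(\sum_i n_ i)) : 'I_(\sum_i n_ i) :=
  Ordinal (omega_nat_lt u).

Lemma eq_sig (u v : 'I_(\sum_i n_ i)) :
  sig1 u = sig1 v -> sig2 u = sig2 v :> nat -> u = v.
Proof.
move=> e1 e2; apply: val_inj; apply/eqP.
by rewrite /= -(sig2K u) -(sig2K v) eq_Rank; apply/andP; split; apply/eqP.
Qed.

Lemma omega_inj : injective omega.
Proof.
move=> u v /(congr1 val) /=.
have [[s es ->]|[s es ->]] := omega_natP u;
  have [[t et ->]|[t et ->]] := omega_natP v.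
- move=> /eqP; rewrite eq_Rank => /andP[/eqP e1 /eqP e2].
  by apply: eq_sig => //; rewrite -es -et.
- move=> e; have := ltn_ord (@Rank _ r_ _ s); rewrite e.
  by rewrite ltnNge leq_addr.
- move=> e; have := ltn_ord (@Rank _ r_ _ t); rewrite -e.
  by rewrite ltnNge leq_addr.
- move=> /eqP; rewrite eqn_add2l eq_Rank => /andP[/eqP e1 /eqP e2].
  by apply: eq_sig => //; rewrite -es -et e2 e1.
Qed.

Definition omega_perm : 'S_(\sum_i n_ i) := perm omega_inj.

End BlockPermutation.

(* Rectangular analogue of [mxdiag]; [conform_mx] only casts [B_ i] along
   the equality of the two block indices. *)
Definition rmxdiag {V : nmodType} {k : nat} {p_ q_ : 'I_k -> nat}
    (B_ : forall i, 'M[V]_(p_ i, q_ i)) : 'M[V]_(\sum_i p_ i, \sum_i q_ i) :=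
  \mxblock_(i, j) (if i == j then conform_mx 0 (B_ i) else 0).

Section Definitions.
Context {R : realType}.
Local Notation C := (R[i]).

Definition Imx (n r : nat) : 'M[C]_(n, r) := pid_mx r.

Definition Iblockmx {k} (n_ r_ : 'I_k -> nat) :
    'M[C]_(\sum_i n_ i, \sum_i r_ i) :=
  rmxdiag (fun i => Imx (n_ i) (r_ i)).

(* [perm_mx s] has its ones at the entries [(u, s u)]. *)
Definition Omegamx {k} {n_ r_ : 'I_k -> nat}
    (le_rn : forall i, (r_ i <= n_ i)%N) : 'M[C]_(\sum_i n_ i) :=
  perm_mx (omega_perm le_rn).

(* In [C], [0 < z] entails that [z] is real. *)
Definition is_svd {n r : nat} (W : 'M[C]_(n, r))
    (U : 'M[C]_n) (N : 'M[C]_r) (V : 'M[C]_r) : Prop :=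
  [/\ U \is unitarymx, V \is unitarymx, is_diag_mx N,
      forall i, 0 < N i i &
      W = U *m Imx n r *m N *m V^t*].

Definition unitarily_equivalent {m n : nat} (X Y : 'M[C]_(m, n)) : Prop :=
  exists (P : 'M[C]_m) (Q : 'M[C]_n),
    [/\ P \is unitarymx, Q \is unitarymx & X = P *m Y *m Q].

(* The [n] square roots of the eigenvalues of [X^* X], with multiplicities, in
   nonincreasing order: one singular value per column of [X]. *)
Definition singular_values {m n : nat} (X : 'M[C]_(m, n)) : seq R :=
  sort >=%R
    [seq Num.sqrt (complex.Re (spectral_diag (X^t* *m X) 0 i)) | i : 'I_n].

(* A family of norms, one for each shape; neither submultiplicativity nor any
   relation between the norms of different shapes is required. *)
Record unitarily_invariant_norm
    (nu : forall m n : nat, 'M[C]_(m, n) -> R) : Prop :=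
  UnitarilyInvariantNorm {
    uinorm_eq0 : forall m n (X : 'M[C]_(m, n)), nu m n X = 0 -> X = 0;
    uinormZ : forall m n (c : C) (X : 'M[C]_(m, n)),
      nu m n (c *: X) = Normc.normc c * nu m n X;
    uinormD : forall m n (X Y : 'M[C]_(m, n)),
      nu m n (X + Y) <= nu m n X + nu m n Y;
    uinorm_unitary : forall m n (P : 'M[C]_m) (X : 'M[C]_(m, n)) (Q : 'M[C]_n),
      P \is unitarymx -> Q \is unitarymx ->
      nu m n (P *m X *m Q) = nu m n X
  }.

Definition is_minimum {T : Type} (f : T -> R) (v : R) : Prop :=
  (exists x, f x = v) /\ (forall x, v <= f x).

Section RayleighQuotient.
Context {l k : nat} {m_ q_ : 'I_l -> nat} {n_ r_ : 'I_k -> nat}.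
Variable A : 'M[C]_(\sum_i m_ i, \sum_j n_ j).
Variables (Um_ : forall i, 'M[C]_(m_ i)) (Vm_ : forall i, 'M[C]_(q_ i)).
Variables (Up_ : forall j, 'M[C]_(n_ j)) (Vp_ : forall j, 'M[C]_(r_ j)).

Definition rayleigh_quotient : 'M[C]_(\sum_i q_ i, \sum_j r_ j) :=
  \mxblock_(i, j)
    (Vm_ i *m (Imx (m_ i) (q_ i))^t* *m (Um_ i)^t* *m submxblock A i j
     *m Up_ j *m Imx (n_ j) (r_ j) *m (Vp_ j)^t*).

Definition deviation_m : 'M[C]_(\sum_i m_ i, \sum_j r_ j) :=
  A *m (\mxdiag_j Up_ j) *m Iblockmx n_ r_ *m (\mxdiag_j Vp_ j)^t*
  - (\mxdiag_i Um_ i) *m Iblockmx m_ q_ *m (\mxdiag_i Vm_ i)^t*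
    *m rayleigh_quotient.

Definition deviation_p : 'M[C]_(\sum_j n_ j, \sum_i q_ i) :=
  A^t* *m (\mxdiag_i Um_ i) *m Iblockmx m_ q_ *m (\mxdiag_i Vm_ i)^t*
  - (\mxdiag_j Up_ j) *m Iblockmx n_ r_ *m (\mxdiag_j Vp_ j)^t*
    *m rayleigh_quotient^t*.

End RayleighQuotient.
End Definitions.

(* Main.v *)
Require Import Defs.

Set Implicit Arguments.
Unset Strict Implicit.
Unset Printing Implicit Defensive.

Import Order.TTheory GRing.Theory Num.Theory.
Local Open Scope ring_scope.
Local Open Scope sesquilinear_scope.

(* Put [J^- = U^- I^q_m (V^-)^*] and [J^+ = U^+ I^r_n (V^+)^*].  As
   [I^q_m = Omega^- (1; 0)], the hypothesis on [hatA] yields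
   [A J^+ - J^- Theta
      = U^- Omega^- (E - (V^-)^* Theta V^+; D^-) (V^+)^*],
   whose upper block vanishes at [Theta = (V^-) E (V^+)^* = E^0].  So [T^-] is
   [(0; D^-)] up to unitary factors, and a unitarily invariant norm does not
   increase when the upper block is set to 0, because [(0; D)] is the mean of
   [(Z; D)] and [diag(-1, 1) (Z; D)].  The claims on [T^+] are those on [T^-]
   for the adjoint matrix. *)

(** * Block diagonal matrices with rectangular blocks *)

Section BlockDiagonal.
Context {S : pzRingType} {a : nat}.

Lemma mul_rmxdiag_mxblock {b : nat} {p_ q_ : 'I_a -> nat} {s_ : 'I_b -> nat}
    (B_ : forall i, 'M[S]_(p_ i, q_ i)) (C_ : forall i j, 'M[S]_(q_ i, s_ j)) :
  rmxdiag B_ *m \mxblock_(i, j) C_ i j = \mxblock_(i, j) (B_ i *m C_ i j).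
Proof.
rewrite mul_mxblock; apply: eq_mxblock => i j.
rewrite (bigD1 i) //= eqxx conform_mx_id big1 ?addr0 // => h.
by rewrite eq_sym => /negPf->; rewrite mul0mx.
Qed.

Lemma mul_mxblock_rmxdiag {b : nat} {p_ q_ : 'I_a -> nat} {s_ : 'I_b -> nat}
    (B_ : forall i, 'M[S]_(p_ i, q_ i)) (C_ : forall j i, 'M[S]_(s_ j, p_ i)) :
  \mxblock_(j, i) C_ j i *m rmxdiag B_ = \mxblock_(j, i) (C_ j i *m B_ i).
Proof.
rewrite mul_mxblock; apply: eq_mxblock => j i.
rewrite (bigD1 i) //= eqxx conform_mx_id big1 ?addr0 // => h.
by move=> /negPf->; rewrite mulmx0.
Qed.

Lemma mul_rmxdiag {p_ q_ s_ : 'I_a -> nat}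
    (B_ : forall i, 'M[S]_(p_ i, q_ i)) (C_ : forall i, 'M[S]_(q_ i, s_ i)) :
  rmxdiag B_ *m rmxdiag C_ = rmxdiag (fun i => B_ i *m C_ i).
Proof.
rewrite mul_rmxdiag_mxblock; apply: eq_mxblock => i j.
by case: eqP => [<-|_]; rewrite ?conform_mx_id ?mulmx0.
Qed.

End BlockDiagonal.

(** * Adjoints and unitary matrices over the complex numbers *)

Section ComplexMatrices.
Context {R : realType}.
Local Notation C := (R[i]).

Lemma adjmx_mul {m n p : nat} (X : 'M[C]_(m, n)) (Y : 'M[C]_(n, p)) :
  (X *m Y)^t* = Y^t* *m X^t*.
Proof. by rewrite trmx_mul map_mxM. Qed.

Lemma adjmxK {m n : nat} (X : 'M[C]_(m, n)) : X^t*^t* = X.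
Proof. by apply/matrixP=> i j; rewrite !mxE conjCK. Qed.

Lemma adj_pid_mx {m n r : nat} : (pid_mx r : 'M[C]_(m, n))^t* = pid_mx r.
Proof. by rewrite tr_pid_mx map_pid_mx. Qed.

Lemma adj_rmxdiag {a : nat} {p_ q_ : 'I_a -> nat}
    (B_ : forall i, 'M[C]_(p_ i, q_ i)) :
  (rmxdiag B_)^t* = rmxdiag (fun i => (B_ i)^t*).
Proof.
apply/mxblockP => i j; rewrite mxblockK.
have -> : submxblock ((rmxdiag B_)^t*) i j = (submxblock (rmxdiag B_) j i)^t*.
  by apply/matrixP => u v; rewrite !mxE.
rewrite mxblockK eq_sym; case: eqP => [->|_]; first by rewrite !conform_mx_id.
by rewrite trmx0 map_mx0.
Qed.

Lemma unitary_mxdiag {a : nat} {p_ : 'I_a -> nat} (U_ : forall i, 'M[C]_(p_ i)) :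
  (forall i, U_ i \is unitarymx) -> \mxdiag_i U_ i \is unitarymx.
Proof.
move=> unitU; apply/unitarymxP.
(* With square blocks, [\mxdiag] is convertible to [rmxdiag]. *)
rewrite -[\mxdiag_i U_ i]/(rmxdiag U_) adj_rmxdiag mul_rmxdiag.
rewrite -(mxdiagZ (p_ := p_)).
by apply: eq_mxdiag => i; apply/unitarymxP.
Qed.

Lemma unitary_perm_mx {n : nat} (s : 'S_n) : (perm_mx s : 'M[C]_n) \is unitarymx.
Proof.
by apply/unitarymxP; rewrite tr_perm_mx map_perm_mx -perm_mxM mulgV perm_mx1.
Qed.

Lemma unitary_mulV {n : nat} (U : 'M[C]_n) : U \is unitarymx -> U^t* *m U = 1%:M.
Proof. by move=> /unitarymxP/mulmx1C. Qed.

(** Both entries at [(u, v)] are 1 exactly when [u] and [v] have the same block and the same offset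
    there: [omega] preserves both for the leading indices of each block and sends all others past
    the last nonzero row of [pid_mx]. *)
Lemma Iblockmx_omega {a : nat} {n_ r_ : 'I_a -> nat}
    (le_rn : forall i, (r_ i <= n_ i)%N) :
  Iblockmx n_ r_ = Omegamx le_rn *m pid_mx (\sum_i r_ i) :> 'M[C]_(_, _).
Proof.
rewrite -row_permE; apply/matrixP => u v; rewrite !mxE permE /=.
have ltv := ltn_ord v.
transitivity
  (((tagnat.sig1 u == tagnat.sig1 v)
     && (tagnat.sig2 u == tagnat.sig2 v :> nat))%:R : C).
  case: eqP => [e|_]; last by rewrite mxE.
  move: (tagnat.sig2 u); rewrite e => s; rewrite conform_mx_id mxE.
  by case: eqP => //= ->; rewrite ltn_ord.
rewrite -[in RHS](tagnat.sig2K v).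
have [[s es ->]|[s es ->]] := omega_natP r_ u.
  by rewrite tagnat.eq_Rank -es ltn_ord andbT.
(* Here [u] has an offset at least [r_] of its block, while the offset of [v] is smaller than [r_]
   of its own, so the left entry is 0 too. *)
rewrite ltnNge leq_addr andbF; congr (_%:R); case: eqP => //= e.
rewrite -es gtn_eqF // (leq_trans (ltn_ord _)) // -e.
by rewrite leq_addl.
Qed.

(** * Characteristic polynomials, spectra and singular values *)

Lemma char_poly_diag_mx {n : nat} (d : 'rV[C]_n) :
  char_poly (diag_mx d) = \prod_(x <- [seq d 0 i | i : 'I_n]) ('X - x%:P).
Proof.
rewrite char_poly_trig ?diag_mx_is_trig // big_map enumT.
by apply: eq_bigr => i _; rewrite mxE eqxx mulr1n.
Qed.

Lemma char_poly_conj {n : nat} (P Q X : 'M[C]_n) :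
  P *m Q = 1%:M -> char_poly (P *m X *m Q) = char_poly X.
Proof.
move=> PQ; have PQ' : map_mx (@polyC C) P *m map_mx (@polyC C) Q = 1%:M.
  by rewrite -map_mxM PQ map_mx1.
rewrite /char_poly /char_poly_mx !map_mxM /=.
have -> : 'X%:M - map_mx (@polyC C) P *m map_mx (@polyC C) X *m map_mx (@polyC C) Q
    = map_mx (@polyC C) P *m ('X%:M - map_mx (@polyC C) X) *m map_mx (@polyC C) Q.
  by rewrite mulmxBr mulmxBl scalar_mxC -[X in _ = X - _]mulmxA PQ' mulmx1.
by rewrite !det_mulmx mulrAC -det_mulmx PQ' det1 mul1r.
Qed.

Lemma gram_normal {m n : nat} (X : 'M[C]_(m, n)) : X^t* *m X \is normalmx.
Proof. by apply/normalmxP; rewrite adjmx_mul adjmxK. Qed.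

Lemma char_poly_spectral {n : nat} (X : 'M[C]_n) : X \is normalmx ->
  char_poly X = \prod_(x <- [seq spectral_diag X 0 i | i : 'I_n]) ('X - x%:P).
Proof.
move=> /orthomx_spectralP {1}->; rewrite char_poly_conj ?char_poly_diag_mx //.
by rewrite mulVmx // unitarymx_unit // spectral_unitarymx.
Qed.

(** Similar Gram matrices share their characteristic polynomial, whose linear factors determine the
    eigenvalues up to order, and sorting removes the order. The row counts may differ, as they do
    for [D^-] and [T^-]. *)
Lemma singular_values_gram {m m' n : nat} (X : 'M[C]_(m, n)) (Y : 'M[C]_(m', n))
    (V : 'M[C]_n) :
  V \is unitarymx -> Y^t* *m Y = V *m (X^t* *m X) *m V^t* ->
  singular_values Y = singular_values X.
Proof.
move=> /unitarymxP unitV gramY; rewrite /singular_values.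
have spec : perm_eq [seq spectral_diag (Y^t* *m Y) 0 i | i : 'I_n]
                    [seq spectral_diag (X^t* *m X) 0 i | i : 'I_n].
  apply: prod_XsubC_eq; rewrite -!char_poly_spectral ?gram_normal //.
  by rewrite gramY char_poly_conj.
apply/(perm_sortP ge_total ge_trans ge_anti).
have := perm_map (fun z => Num.sqrt (complex.Re z)) spec.
by rewrite /image_mem -!map_comp.
Qed.

(** * Unitarily invariant norms and minimality of the deviation *)

Section UnitarilyInvariantNorm.
Context {nu : forall m n : nat, 'M[C]_(m, n) -> R}.
Hypothesis nu_ui : unitarily_invariant_norm nu.

Lemma uinorm_col0_le {m1 m2 n : nat} (Z : 'M[C]_(m1, n)) (D : 'M[C]_(m2, n)) :
  nu (col_mx (0 : 'M_(m1, n)) D) <= nu (col_mx Z D).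
Proof.
pose J : 'M[C]_(m1 + m2) := block_mx (-1)%:M 0 0 1%:M.
have unitJ : J \is unitarymx.
  apply/unitarymxP; rewrite tr_block_mx map_block_mx mulmx_block.
  rewrite !trmx0 !map_mx0 !tr_scalar_mx !map_scalar_mx /=.
  rewrite conj_Creal ?rpredN1 //.
  rewrite conjC1 -!scalar_mxM !mul0mx !mulmx0.
  by rewrite mulrNN !mulr1 !addr0 !add0r -scalar_mx_block.
have unit1 : (1%:M : 'M[C]_n) \is unitarymx.
  by apply/unitarymxP; rewrite trmx1 map_mx1 mulmx1.
have JZD : J *m col_mx Z D *m 1%:M = col_mx (- Z) D.
  rewrite mulmx1 mul_block_col !mul_scalar_mx scaleN1r scale1r !mul0mx.
  by rewrite addr0 add0r.
have /(congr1 (@nu (m1 + m2)%N n)) : (2%:R : C) *: col_mx (0 : 'M_(m1, n)) D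
    = col_mx Z D + col_mx (- Z) D.
  by rewrite scale_col_mx scaler0 add_col_mx subrr scaler_nat mulr2n.
rewrite (uinormZ nu_ui) => nu2.
have := uinormD nu_ui (col_mx Z D) (col_mx (- Z) D).
rewrite -nu2 -JZD (uinorm_unitary nu_ui) //.
have -> : Normc.normc (2%:R : C) = 2%:R.
  by rewrite -[2%:R](_ : (1 : C) *+ 2 = _) // normcMn Normc.normc1.
by rewrite -mulr2n mulr_natl ler_pMn2r.
Qed.

(** The core of the theorem, freed from the block structure: [P] and [Q] stand for [U Omega], so
    that [J] and [K] become [J^-] and [J^+]. With [A] arbitrary, it serves for the given matrix and
    for its adjoint. *)
Lemma deviation_minimal {m n m' n' q r : nat}
    (em : (q + m' = m)%N) (en : (r + n' = n)%N)
    (A : 'M[C]_(m, n)) (P : 'M[C]_m) (Q : 'M[C]_n) (V : 'M[C]_q) (W : 'M[C]_r)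
    (E : 'M[C]_(q, r)) (B : 'M[C]_(q, n')) (D : 'M[C]_(m', r))
    (F : 'M[C]_(m', n'))
    (J := P *m pid_mx q *m V^t*) (K := Q *m pid_mx r *m W^t*) :
  P \is unitarymx -> Q \is unitarymx -> V \is unitarymx -> W \is unitarymx ->
  P^t* *m A *m Q = castmx (em, en) (block_mx E B D F) ->
  [/\ J^t* *m A *m K = V *m E *m W^t*,
      singular_values (A *m K - J *m (J^t* *m A *m K)) = singular_values D &
      is_minimum (fun Theta => nu (A *m K - J *m Theta))
        (nu (A *m K - J *m (J^t* *m A *m K)))].
Proof.
(* Eliminating the size equations turns [m] and [n] into literal sums, so the cast disappears. *)
move: P A Q em en @J @K => + + + em; case: _ / em => P + + en.
case: _ / en => A Q J K unitP unitQ unitV unitW; rewrite castmx_id => hatA.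
have PA : A *m Q = P *m block_mx E B D F.
  by rewrite -hatA !mulmxA (unitarymxP unitP) mul1mx.
have AK : A *m K = P *m col_mx E D *m W^t*.
  rewrite /K !mulmxA PA -!(mulmxA P) pid_mx_col mul_block_col.
  by rewrite !mulmx1 !mulmx0 !addr0.
have E0 : J^t* *m A *m K = V *m E *m W^t*.
  rewrite -mulmxA AK /J !adjmx_mul adjmxK adj_pid_mx !mulmxA.
  rewrite -(mulmxA _ (P^t*)) (unitary_mulV unitP) mulmx1 pid_mx_row.
  by rewrite -(mulmxA V (row_mx _ _)) mul_row_col mul1mx mul0mx addr0.
have dev Theta :
    A *m K - J *m Theta = P *m col_mx (E - V^t* *m Theta *m W) D *m W^t*.
  rewrite AK /J pid_mx_col.
  (* Inserting [W *m W^t* = 1] lets both terms share the right factor [W^t*]. *)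
  have -> : P *m col_mx 1%:M 0 *m V^t* *m Theta
      = P *m col_mx (V^t* *m Theta *m W) 0 *m W^t*.
    rewrite -!mulmxA !mul_col_mx !mul0mx mul1mx -!mulmxA.
    by rewrite (unitarymxP unitW) mulmx1.
  by rewrite -mulmxBl -mulmxBr opp_col_mx add_col_mx subr0.
have dev0 : A *m K - J *m (J^t* *m A *m K) = P *m col_mx 0 D *m W^t*.
  rewrite dev E0 !mulmxA (unitary_mulV unitV) mul1mx -(mulmxA E).
  by rewrite (unitary_mulV unitW) mulmx1 subrr.
have unitW' : W^t* \is unitarymx by rewrite trmxC_unitary.
split=> //.
  (* [P] cancels in the Gram matrix and the zero block adds nothing, which leaves [W D^* D W^*]. *)
  apply: (singular_values_gram unitW); rewrite dev0 !adjmx_mul adjmxK !mulmxA.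
  rewrite -(mulmxA _ (P^t*)) (unitary_mulV unitP) mulmx1.
  rewrite tr_col_mx map_row_mx -(mulmxA W (row_mx _ _)) mul_row_col.
  by rewrite mulmx0 add0r !mulmxA.
split; first by exists (J^t* *m A *m K).
by move=> Theta; rewrite dev0 dev !(uinorm_unitary nu_ui) // uinorm_col0_le.
Qed.

End UnitarilyInvariantNorm.

(** Block diagonal factors act on each block of [A] separately. This puts the quotient in the form
    [J^t* *m A *m K] of [deviation_minimal]. *)
Lemma rayleigh_quotientE {l k : nat} {m_ q_ : 'I_l -> nat} {n_ r_ : 'I_k -> nat}
    (A : 'M[C]_(\sum_i m_ i, \sum_j n_ j))
    (Um_ : forall i, 'M[C]_(m_ i)) (Vm_ : forall i, 'M[C]_(q_ i))
    (Up_ : forall j, 'M[C]_(n_ j)) (Vp_ : forall j, 'M[C]_(r_ j)) :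
  rayleigh_quotient A Um_ Vm_ Up_ Vp_
    = (\mxdiag_i Um_ i *m Iblockmx m_ q_ *m (\mxdiag_i Vm_ i)^t*)^t* *m A
      *m (\mxdiag_j Up_ j *m Iblockmx n_ r_ *m (\mxdiag_j Vp_ j)^t*).
Proof.
rewrite -[\mxdiag_i Um_ i]/(rmxdiag Um_) -[\mxdiag_i Vm_ i]/(rmxdiag Vm_).
rewrite -[\mxdiag_i Up_ i]/(rmxdiag Up_) -[\mxdiag_i Vp_ i]/(rmxdiag Vp_).
rewrite !adj_rmxdiag !mul_rmxdiag adj_rmxdiag -[A in RHS]submxblockK.
rewrite mul_rmxdiag_mxblock mul_mxblock_rmxdiag; apply: eq_mxblock => i j.
by rewrite !adjmx_mul adjmxK !mulmxA.
Qed.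

End ComplexMatrices.

Theorem theorem2 (R : realType) (l k : nat)
    (m_ q_ : 'I_l -> nat) (n_ r_ : 'I_k -> nat)
    (le_qm : forall i, (q_ i <= m_ i)%N) (le_rn : forall j, (r_ j <= n_ j)%N)
    (A : 'M[R[i]]_(\sum_i m_ i, \sum_j n_ j))
    (* W^-, its diagonal blocks and their singular value decompositions *)
    (Wm : 'M[R[i]]_(\sum_i m_ i, \sum_i q_ i))
    (Wm_ : forall i, 'M[R[i]]_(m_ i, q_ i))
    (Um_ : forall i, 'M[R[i]]_(m_ i))
    (Nm_ Vm_ : forall i, 'M[R[i]]_(q_ i))
    (Wm_diag : Wm = rmxdiag Wm_)
    (Wm_rank : forall i, \rank (Wm_ i) = q_ i)
    (Wm_svd : forall i, is_svd (Wm_ i) (Um_ i) (Nm_ i) (Vm_ i))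
    (* W^+, its diagonal blocks and their singular value decompositions *)
    (Wp : 'M[R[i]]_(\sum_j n_ j, \sum_j r_ j))
    (Wp_ : forall j, 'M[R[i]]_(n_ j, r_ j))
    (Up_ : forall j, 'M[R[i]]_(n_ j))
    (Np_ Vp_ : forall j, 'M[R[i]]_(r_ j))
    (Wp_diag : Wp = rmxdiag Wp_)
    (Wp_rank : forall j, \rank (Wp_ j) = r_ j)
    (Wp_svd : forall j, is_svd (Wp_ j) (Up_ j) (Np_ j) (Vp_ j))
    (* the blocks of the transformed matrix *)
    (E : 'M[R[i]]_(\sum_i q_ i, \sum_j r_ j))
    (Dm : 'M[R[i]]_(\sum_i m_ i - \sum_i q_ i, \sum_j r_ j))
    (Dp : 'M[R[i]]_(\sum_j n_ j - \sum_j r_ j, \sum_i q_ i))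
    (F : 'M[R[i]]_(\sum_i m_ i - \sum_i q_ i, \sum_j n_ j - \sum_j r_ j))
    (hatA : (Omegamx le_qm)^t* *m (\mxdiag_i Um_ i)^t* *m A
              *m (\mxdiag_j Up_ j) *m Omegamx le_rn
            = castmx (sum_sizesK le_qm, sum_sizesK le_rn)
                (block_mx E (Dp^t*) Dm F))
    (nu : forall a b : nat, 'M[R[i]]_(a, b) -> R)
    (nu_ui : unitarily_invariant_norm nu) :
  [/\ unitarily_equivalent E (rayleigh_quotient A Um_ Vm_ Up_ Vp_),
      singular_values Dm = singular_values (deviation_m A Um_ Vm_ Up_ Vp_),
      singular_values Dp = singular_values (deviation_p A Um_ Vm_ Up_ Vp_),
      is_minimum
        (fun Theta : 'M[R[i]]_(\sum_i q_ i, \sum_j r_ j) =>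
           nu _ _ (A *m (\mxdiag_j Up_ j) *m Iblockmx n_ r_
                     *m (\mxdiag_j Vp_ j)^t*
                   - (\mxdiag_i Um_ i) *m Iblockmx m_ q_
                     *m (\mxdiag_i Vm_ i)^t* *m Theta))
        (nu _ _ (deviation_m A Um_ Vm_ Up_ Vp_)) &
      is_minimum
        (fun Theta : 'M[R[i]]_(\sum_i q_ i, \sum_j r_ j) =>
           nu _ _ (A^t* *m (\mxdiag_i Um_ i) *m Iblockmx m_ q_
                     *m (\mxdiag_i Vm_ i)^t*
                   - (\mxdiag_j Up_ j) *m Iblockmx n_ r_
                     *m (\mxdiag_j Vp_ j)^t* *m Theta^t*))
        (nu _ _ (deviation_p A Um_ Vm_ Up_ Vp_))].
Proof.
have unitU a b W U N V : @is_svd R a b W U N V -> U \is unitarymx by case.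
have unitV a b W U N V : @is_svd R a b W U N V -> V \is unitarymx by case.
have unitUm := unitary_mxdiag (fun i => unitU _ _ _ _ _ _ (Wm_svd i)).
have unitUp := unitary_mxdiag (fun j => unitU _ _ _ _ _ _ (Wp_svd j)).
have unitVm := unitary_mxdiag (fun i => unitV _ _ _ _ _ _ (Wm_svd i)).
have unitVp := unitary_mxdiag (fun j => unitV _ _ _ _ _ _ (Wp_svd j)).
have unitP := mul_unitarymx unitUm (unitary_perm_mx (R := R) (omega_perm le_qm)).
have unitQ := mul_unitarymx unitUp (unitary_perm_mx (R := R) (omega_perm le_rn)).
have hatA' : (\mxdiag_i Um_ i *m Omegamx le_qm)^t* *m A
      *m (\mxdiag_j Up_ j *m Omegamx le_rn)
    = castmx (sum_sizesK le_qm, sum_sizesK le_rn) (block_mx E (Dp^t*) Dm F).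
  by rewrite -hatA adjmx_mul !mulmxA.
(* Taking adjoints exchanges the two sides and moves [Dp] to the lower left block. *)
have hatA'' : (\mxdiag_j Up_ j *m Omegamx le_rn)^t* *m A^t*
      *m (\mxdiag_i Um_ i *m Omegamx le_qm)
    = castmx (sum_sizesK le_rn, sum_sizesK le_qm)
        (block_mx (E^t*) (Dm^t*) Dp (F^t*)).
  have := congr1 (fun X => X^t*) hatA'.
  rewrite !adjmx_mul !adjmxK mulmxA => ->.
  by rewrite trmx_cast map_castmx tr_block_mx map_block_mx adjmxK.
have [E0 svm minm] := deviation_minimal nu_ui unitP unitQ unitVm unitVp hatA'.
have [_ svp minp] := deviation_minimal nu_ui unitQ unitP unitVp unitVm hatA''.
move: E0 svm minm svp minp; rewrite -!(mulmxA _ (Omegamx _)) -!Iblockmx_omega.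
set J := \mxdiag_i Um_ i *m Iblockmx m_ q_ *m (\mxdiag_i Vm_ i)^t*.
set K := \mxdiag_j Up_ j *m Iblockmx n_ r_ *m (\mxdiag_j Vp_ j)^t*.
have <- := rayleigh_quotientE A Um_ Vm_ Up_ Vp_.
(* The Rayleigh quotient of the adjoint problem is the adjoint of [E^0]. *)
have -> : K^t* *m A^t* *m J = (rayleigh_quotient A Um_ Vm_ Up_ Vp_)^t*.
  rewrite rayleigh_quotientE -/J -/K [RHS]adjmx_mul (adjmx_mul (J^t*) A).
  by rewrite adjmxK mulmxA.
have AK : A *m \mxdiag_j Up_ j *m Iblockmx n_ r_ *m (\mxdiag_j Vp_ j)^t* = A *m K.
  by rewrite /K !mulmxA.
have AJ : A^t* *m \mxdiag_i Um_ i *m Iblockmx m_ q_ *m (\mxdiag_i Vm_ i)^t*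
    = A^t* *m J.
  by rewrite /J !mulmxA.
rewrite /deviation_m /deviation_p AK AJ => E0 svm minm svp [_ minp].
split=> //.
(* These factors invert [E^0 = V^- E (V^+)^*]. *)
- exists ((\mxdiag_i Vm_ i)^t*), (\mxdiag_j Vp_ j).
  split; rewrite ?trmxC_unitary // E0 !mulmxA (unitary_mulV unitVm) mul1mx.
  by rewrite -mulmxA (unitary_mulV unitVp) mulmx1.
(* The lower bound over all matrices applies in particular to [Theta^t*], and the minimizer
   [(E^0)^*] is itself of this form. *)
- split=> [|Theta]; last exact: minp.
  by exists (rayleigh_quotient A Um_ Vm_ Up_ Vp_).
Qed.
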